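(* Let $G$ be a finite group and let $p$ be a prime. Suppose that $x\in G$ is a $p$-element such that $xy$ is $p$-regular for every nontrivial $p$-regular element $y\in G$. Then $x\in O_p(G)$.
   Context: An element $g\in G$ is a $p$-element if its order is a power of $p$, and is $p$-regular if its order is not divisible by $p$. $O_p(G)$ denotes the largest normal $p$-subgroup of $G$. *)

(* Defs.v *)
(* MathComp world (finite groups). *)
From mathcomp Require Import all_boot fingroup pgroup.
Set Implicit Arguments.
Unset Strict Implicit.
Unset Printing Implicit Defensive.

(* Main.v *)
Require Import Defs.
From mathcomp Require Import all_boot fingroup pgroup.
Local Open Scope group_scope.

(** Let S be the set of nontrivial p-regular elements of G. The product of the
    p-element x with some y in S is never 1, since y would then be both a
    p-element and p-regular; so the hypothesis says exactly that left
    multiplication by x maps S into itself. The elements of G with this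
    property form a subgroup K, normal because S is invariant under
    conjugation. Finally K avoids S: an element y of both would carry y^-1,
    which is again in S, to 1, which is not. By Cauchy's theorem K is then a
    p-group, and a normal p-subgroup lies in 'O_p(G) ([pcore_max]). *)

Section RegularTranslations.

Variables (gT : finGroupType) (G : {group gT}) (p : nat).

Definition nontrivial_regular := [set y in G^# | p^'.-elt y].

Definition regular_translations :=
  [set g in G | [forall y in nontrivial_regular,
                   g * y \in nontrivial_regular]].

Lemma regular_translationsP g :
  reflect (g \in G /\ {in nontrivial_regular, forall y,
                         g * y \in nontrivial_regular})
          (g \in regular_translations).
Proof.
rewrite inE; apply: (iffP andP) => -[Gg gP]; split=> //.
  exact/forall_inP.
exact/forall_inP.
Qed.

(** Closure under inverses is automatic, G being finite. *)
Lemma regular_translations_group_set : group_set regular_translations.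
Proof.
apply/group_setP; split=> [|g h].
  by apply/regular_translationsP; split=> // y; rewrite mul1g.
case/regular_translationsP=> Gg gS /regular_translationsP[Gh hS].
apply/regular_translationsP; split=> [|y Sy]; first exact: groupM.
by rewrite -mulgA gS ?hS.
Qed.

Canonical regular_translations_group := Group regular_translations_group_set.

Lemma nontrivial_regularJ a y :
  a \in G -> (y ^ a \in nontrivial_regular) = (y \in nontrivial_regular).
Proof. by move=> Ga; rewrite !inE conjg_eq1 groupJr // p_eltJ. Qed.

Lemma regular_translations_normal : regular_translations <| G.
Proof.
apply/andP; split; first by apply/subsetP=> g /regular_translationsP[].
apply/subsetP=> a Ga; rewrite inE; apply/subsetP=> _ /imsetP[g Kg ->].
have [Gg gS] := regular_translationsP _ Kg.
apply/regular_translationsP; split=> [|y Sy]; first exact: groupJ.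
rewrite -(nontrivial_regularJ a^-1) ?groupV // conjMg conjgK gS //.
by rewrite nontrivial_regularJ ?groupV.
Qed.

Lemma regular_translations_pgroup : p.-group regular_translations.
Proof.
apply/pgroupP=> q q_pr /(Cauchy q_pr)[y Ky oy].
have [Gy yS] := regular_translationsP _ Ky.
apply: contraT => p'q.
have Sy' : y^-1 \in nontrivial_regular.
  rewrite !inE eq_invg1 groupV Gy -order_gt1 oy prime_gt1 //= p_eltV /p_elt oy.
  by rewrite pnatE.
by have := yS _ Sy'; rewrite mulgV !inE eqxx.
Qed.

End RegularTranslations.

Theorem theorem5 (gT : finGroupType) (G : {group gT}) (p : nat) (x : gT)
  (p_pr : prime p) (Gx : x \in G) (p_x : p.-elt x)
  (hxy : forall y : gT, y \in G -> y != 1 -> p^'.-elt y -> p^'.-elt (x * y)) :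
  x \in 'O_p(G).
Proof.
have KO : regular_translations gT G p \subset 'O_p(G).
  by apply: pcore_max;
    [exact: regular_translations_pgroup | exact: regular_translations_normal].
apply: (subsetP KO); apply/regular_translationsP; split=> // y.
rewrite !inE => /andP[/andP[y1 Gy] p'y].
rewrite groupM // hxy // !andbT.
apply: contra y1 => /eqP/(canRL (mulKg x)) def_y.
(* Here y = x^-1 is a p-element as well as p-regular. *)
by rewrite -order_eq1 (@pnat_1 p _ _ p'y) // def_y mulg1 orderV.
Qed.
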